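(* Let $W=W_{A_{n-1}}$ ($n\ge2$), $W_{B_n}$ ($n\ge2$), or $W_{D_n}$ ($n\ge4$), let $\mathfrak{H}^-_W$ be the degenerate spin affine Hecke algebra and $\mathfrak{I}_i\in\mathfrak{H}^-_W$ the intertwiners. The following identities hold in $\mathfrak{H}^-_W$: (1) for every such $W$, $1\le i\le n-1$ and $1\le j\le n$: $\mathfrak{I}_ib_i=-b_{i+1}\mathfrak{I}_i$, $\mathfrak{I}_ib_{i+1}=-b_i\mathfrak{I}_i$, and $\mathfrak{I}_ib_j=-b_j\mathfrak{I}_i$ if $j\ne i,i+1$; (2) in type $D_n$: $\mathfrak{I}_nb_{n-1}=-b_n\mathfrak{I}_n$, $\mathfrak{I}_nb_n=-b_{n-1}\mathfrak{I}_n$, and $\mathfrak{I}_nb_i=-b_i\mathfrak{I}_n$ for $i\ne n-1,n$; (3) in type $B_n$: $\mathfrak{I}_nb_n=-b_n\mathfrak{I}_n$, and $\mathfrak{I}_nb_i=-b_i\mathfrak{I}_n$ for $i\ne n$.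
   Context: All algebras are unital associative over $\mathbb{C}$; $u,v\in\mathbb{C}$ are parameters. $\mathfrak{H}^-_W$ is generated by $b_1,\dots,b_n$ and $t_1,\dots,t_{n-1}$ (type $A_{n-1}$), or $b_1,\dots,b_n$ and $t_1,\dots,t_n$ (types $B_n$, $D_n$), subject to: $t_i^2=1$; $t_it_{i+1}t_i=t_{i+1}t_it_{i+1}$ ($1\le i\le n-2$); $t_it_j=-t_jt_i$ ($|i-j|>1$, $i,j\le n-1$); in type $D_n$: $t_it_n=-t_nt_i$ ($i\neq n-2,n$), $t_{n-2}t_nt_{n-2}=t_nt_{n-2}t_n$; in type $B_n$: $t_it_n=-t_nt_i$ ($i\le n-2$), $(t_{n-1}t_n)^4=-1$; $b_ib_j=-b_jb_i$ ($i\neq j$); for $1\le i\le n-1$: $t_ib_i+b_{i+1}t_i=u$, $t_ib_j=-b_jt_i$ ($j\neq i,i+1$); in type $D_n$: $t_nb_n+b_{n-1}t_n=u$, $t_nb_i=-b_it_n$ ($i\ne n-1,n$); in type $B_n$: $t_nb_n+b_nt_n=v$, $t_nb_i=-b_it_n$ ($i\neq n$). Intertwiners: $\mathfrak{I}_i=(b_{i+1}^2-b_i^2)t_i-u(b_{i+1}-b_i)$ ($1\le i\le n-1$); in type $D_n$, $\mathfrak{I}_n=(b_n^2-b_{n-1}^2)t_n-u(b_n-b_{n-1})$; in type $B_n$, $\mathfrak{I}_n=2b_n^2t_n-vb_n$. *)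

(* Defs.v *)
From HB Require Import structures.
From mathcomp Require Import all_boot all_order all_algebra.
From mathcomp Require Import finmap boolp.
From mathcomp.multinomials Require Import monalg.

Set Implicit Arguments.
Unset Strict Implicit.
Unset Printing Implicit Defensive.

Import GRing.Theory.
Local Open Scope ring_scope.
Local Open Scope quotient_scope.

(* Algebras by generators and relations: [freeAlg K X] is the monoid algebra  *)
(* of the free monoid on X, and [presAlg S] its quotient by the two-sided     *)
(* ideal generated by the x - y with S x y.  Nothing guarantees 1 != 0 for an *)
(* arbitrary S, so the quotient is a pzRingType and an lmodType but not an    *)
(* algType, a structure that requires 1 != 0; the remaining algebra axioms    *)
(* are the lemmas presAlg_scalerAl and presAlg_scalerAr.                      *)

Notation freeAlg K X := {malg K[{fmonom X}]}.

Section FreeAlgebra.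
Variables (K : comNzRingType) (X : choiceType).

Lemma freeAlg_scalerAr (k : K) (x y : freeAlg K X) :
  k *: (x * y) = x * (k *: y).
Proof.
apply/malgP => m; rewrite mcoeffZ.
rewrite !(@mcoeffMrw _ _ (msupp x) (msupp y)) ?fsubset_refl ?msuppZ_le //.
rewrite mulr_sumr; apply: eq_bigr => a _.
rewrite mulr_sumr; apply: eq_bigr => b _.
by rewrite mcoeffZ mulrnAr mulrCA.
Qed.

End FreeAlgebra.

Section Presentation.
Variables (K : comNzRingType) (X : choiceType).
Local Notation F := (freeAlg K X).
Variable S : F -> F -> Prop.

Inductive rel_ideal : F -> Prop :=
| rel_ideal_gen x y of S x y : rel_ideal (x - y)
| rel_ideal0 : rel_ideal 0
| rel_idealB x y of rel_ideal x & rel_ideal y : rel_ideal (x - y)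
| rel_idealMl a x of rel_ideal x : rel_ideal (a * x)
| rel_idealMr a x of rel_ideal x : rel_ideal (x * a).

Definition rel_ideal_pred : pred F := fun x => `[< rel_ideal x >].

Lemma rel_idealE x : (x \in rel_ideal_pred) = `[< rel_ideal x >].
Proof. by []. Qed.

Lemma rel_ideal_zmod_closed : zmod_closed rel_ideal_pred.
Proof.
split; first by apply/asboolP; exact: rel_ideal0.
by move=> x y /asboolP Ix /asboolP Iy; apply/asboolP; exact: rel_idealB.
Qed.

HB.instance Definition _ :=
  GRing.isZmodClosed.Build F rel_ideal_pred rel_ideal_zmod_closed.

Definition rel_zmodClosed : zmodClosed F :=
  GRing.ZmodClosed.clone F rel_ideal_pred _.

Definition presAlg := @Quotient.quot F rel_zmodClosed.

HB.instance Definition _ := GRing.Zmodule.on presAlg.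
HB.instance Definition _ : EqQuotient F (Quotient.equiv rel_zmodClosed) presAlg
  := EqQuotient.on presAlg.
HB.instance Definition _ : isZmodQuotient F
    (Quotient.equiv rel_zmodClosed) 0 -%R +%R presAlg
  := ZmodQuotient.on presAlg.

Lemma presAlgW (P : presAlg -> Prop) :
  (forall x, P (\pi_presAlg x)) -> forall x, P x.
Proof. by move=> Ppi x; rewrite -[x]reprK. Qed.

Lemma presAlg_eqP x y : \pi_presAlg x = \pi_presAlg y <-> rel_ideal (x - y).
Proof.
split=> [/eqP|I]; first by rewrite -Quotient.idealrBE => /asboolP.
by apply/eqP; rewrite -Quotient.idealrBE; apply/asboolP.
Qed.

Lemma presAlg_rel x y : S x y -> \pi_presAlg x = \pi_presAlg y.
Proof. by move=> Sxy; apply/presAlg_eqP; exact: rel_ideal_gen. Qed.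

Let repr_pi x : rel_ideal (repr (\pi_presAlg x) - x).
Proof. by apply/presAlg_eqP; rewrite reprK. Qed.

Definition presAlg_one : presAlg := \pi_presAlg 1.
Definition presAlg_mul (x y : presAlg) : presAlg :=
  \pi_presAlg (repr x * repr y).
Definition presAlg_scale (k : K) (x : presAlg) : presAlg :=
  \pi_presAlg (k *: repr x).

Let pi_mul x y :
  presAlg_mul (\pi_presAlg x) (\pi_presAlg y) = \pi_presAlg (x * y).
Proof.
apply/presAlg_eqP; set x' := repr _; set y' := repr _.
have -> : x' * y' - x * y = x' * (y' - y) - (x - x') * y.
  by rewrite mulrBr mulrBl opprB addrA subrK.
apply: rel_idealB; first exact/rel_idealMl/repr_pi.
apply: rel_idealMr; rewrite -opprB -sub0r.
by apply: rel_idealB; [exact: rel_ideal0|exact: repr_pi].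
Qed.

Let pi_scale k x : presAlg_scale k (\pi_presAlg x) = \pi_presAlg (k *: x).
Proof.
apply/presAlg_eqP; rewrite -scalerBr -[X in _ *: X]mul1r scalerAl.
exact/rel_idealMl/repr_pi.
Qed.

Let piD (x y : F) : \pi_presAlg (x + y) = \pi_presAlg x + \pi_presAlg y.
Proof. by rewrite !piE. Qed.

Let presE := (pi_mul, pi_scale, =^~ piD).

Fact presAlg_mulA : associative presAlg_mul.
Proof. move=> x y z; elim/presAlgW: x; elim/presAlgW: y; elim/presAlgW: z => z y x.
by rewrite !presE mulrA. Qed.

Fact presAlg_mul1l : left_id presAlg_one presAlg_mul.
Proof. by move=> x; elim/presAlgW: x => x; rewrite /presAlg_one !presE mul1r. Qed.

Fact presAlg_mul1r : right_id presAlg_one presAlg_mul.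
Proof. by move=> x; elim/presAlgW: x => x; rewrite /presAlg_one !presE mulr1. Qed.

Fact presAlg_mulDl : left_distributive presAlg_mul +%R.
Proof.
move=> x y z; elim/presAlgW: x; elim/presAlgW: y; elim/presAlgW: z => z y x.
by rewrite !presE mulrDl.
Qed.

Fact presAlg_mulDr : right_distributive presAlg_mul +%R.
Proof.
move=> x y z; elim/presAlgW: x; elim/presAlgW: y; elim/presAlgW: z => z y x.
by rewrite !presE mulrDr.
Qed.

HB.instance Definition _ := GRing.Zmodule_isPzRing.Build presAlg
  presAlg_mulA presAlg_mul1l presAlg_mul1r presAlg_mulDl presAlg_mulDr.

Fact presAlg_scaleA a b v :
  presAlg_scale a (presAlg_scale b v) = presAlg_scale (a * b) v.
Proof. by elim/presAlgW: v => x; rewrite !presE scalerA. Qed.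

Fact presAlg_scale1 : left_id 1 presAlg_scale.
Proof. by move=> x; elim/presAlgW: x => x; rewrite !presE scale1r. Qed.

Fact presAlg_scaleDr : right_distributive presAlg_scale +%R.
Proof. move=> a x y; elim/presAlgW: x; elim/presAlgW: y => y x.
by rewrite !presE scalerDr. Qed.

Fact presAlg_scaleDl v : {morph presAlg_scale^~ v : a b / a + b}.
Proof. by move=> a b /=; elim/presAlgW: v => x; rewrite !presE scalerDl. Qed.

HB.instance Definition _ := GRing.Zmodule_isLmodule.Build K presAlg
  presAlg_scaleA presAlg_scale1 presAlg_scaleDr presAlg_scaleDl.

Lemma presAlg_scalerAl (k : K) (x y : presAlg) : k *: (x * y) = (k *: x) * y.
Proof.
elim/presAlgW: x => x; elim/presAlgW: y => y; rewrite /GRing.scale /GRing.mul /=.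
by rewrite !presE scalerAl.
Qed.

Lemma presAlg_scalerAr (k : K) (x y : presAlg) : k *: (x * y) = x * (k *: y).
Proof.
elim/presAlgW: x => x; elim/presAlgW: y => y; rewrite /GRing.scale /GRing.mul /=.
by rewrite !presE freeAlg_scalerAr.
Qed.

Lemma pi_presAlg_monoid_morphism : monoid_morphism \pi_presAlg.
Proof. by split=> // x y; rewrite -pi_mul. Qed.

Lemma pi_presAlg_zmod_morphism : zmod_morphism \pi_presAlg.
Proof. by move=> x y; rewrite !piE. Qed.

Lemma pi_presAlg_scalable : scalable \pi_presAlg.
Proof. by move=> k x; rewrite -pi_scale. Qed.

End Presentation.

(* TypeA at n stands for the Weyl group of type A_{n-1}. *)
Variant weyl_type := TypeA | TypeB | TypeD.

Definition num_t (W : weyl_type) (n : nat) : nat :=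
  if W is TypeA then n.-1 else n.

Definition index_upto (k : nat) := {i : nat | (0 < i <= k)%N}.

HB.instance Definition _ k := Choice.on (index_upto k).

Definition spin_gen (W : weyl_type) (n : nat) : choiceType :=
  (index_upto n + index_upto (num_t W n))%type.

Section SpinAffineHecke.
Variables (K : comNzRingType) (W : weyl_type) (n : nat) (u v : K).
Local Notation F := (freeAlg K (spin_gen W n)).

(* Indices run from 1. Outside 1..n, resp. 1..num_t W n, the values below are *)
(* the junk value 0; no such index occurs in spin_rel when n >= 2 (n >= 3 in  *)
(* type D).                                                                   *)
Definition free_b (i : nat) : F :=
  if insub i is Some k then << fmu (inl k : spin_gen W n) >> else 0.

Definition free_t (i : nat) : F :=
  if insub i is Some k then << fmu (inr k : spin_gen W n) >> else 0.

Local Notation b := free_b.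
Local Notation t := free_t.

Inductive spin_rel : F -> F -> Prop :=
| spin_t_sqr i of (1 <= i <= num_t W n)%N :
    spin_rel (t i ^+ 2) 1
| spin_t_braid i of (1 <= i <= n - 2)%N :
    spin_rel (t i * t i.+1 * t i) (t i.+1 * t i * t i.+1)
| spin_t_anti i j of (1 <= i <= n - 1)%N & (1 <= j <= n - 1)%N
    & (i.+1 < j)%N || (j.+1 < i)%N :
    spin_rel (t i * t j) (- (t j * t i))
| spin_t_antiD i of W = TypeD & (1 <= i <= n)%N & i != (n - 2)%N & i != n :
    spin_rel (t i * t n) (- (t n * t i))
| spin_t_braidD of W = TypeD :
    spin_rel (t (n - 2) * t n * t (n - 2)) (t n * t (n - 2) * t n)
| spin_t_antiB i of W = TypeB & (1 <= i <= n - 2)%N :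
    spin_rel (t i * t n) (- (t n * t i))
| spin_t_braidB of W = TypeB :
    spin_rel ((t (n - 1) * t n) ^+ 4) (- 1)
| spin_b_anti i j of (1 <= i <= n)%N & (1 <= j <= n)%N & i != j :
    spin_rel (b i * b j) (- (b j * b i))
| spin_tb i of (1 <= i <= n - 1)%N :
    spin_rel (t i * b i + b i.+1 * t i) u%:A
| spin_tb_anti i j of (1 <= i <= n - 1)%N & (1 <= j <= n)%N
    & j != i & j != i.+1 :
    spin_rel (t i * b j) (- (b j * t i))
| spin_tbD of W = TypeD :
    spin_rel (t n * b n + b (n - 1) * t n) u%:A
| spin_tb_antiD i of W = TypeD & (1 <= i <= n)%N & i != (n - 1)%N & i != n :
    spin_rel (t n * b i) (- (b i * t n))
| spin_tbB of W = TypeB :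
    spin_rel (t n * b n + b n * t n) v%:A
| spin_tb_antiB i of W = TypeB & (1 <= i <= n)%N & i != n :
    spin_rel (t n * b i) (- (b i * t n)).

(* The parameter v is only relevant in type B. *)
Definition spin_hecke := presAlg spin_rel.

HB.instance Definition _ := GRing.PzRing.on spin_hecke.
HB.instance Definition _ := GRing.Lmodule.on spin_hecke.

Definition spin_b (i : nat) : spin_hecke := \pi_(presAlg spin_rel) (free_b i).
Definition spin_t (i : nat) : spin_hecke := \pi_(presAlg spin_rel) (free_t i).

Definition intertwiner (i : nat) : spin_hecke :=
  (spin_b i.+1 ^+ 2 - spin_b i ^+ 2) * spin_t i
    - u *: (spin_b i.+1 - spin_b i).

(* The intertwiners of index n in types D and B. *)
Definition intertwinerD : spin_hecke :=
  (spin_b n ^+ 2 - spin_b (n - 1) ^+ 2) * spin_t n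
    - u *: (spin_b n - spin_b (n - 1)).

Definition intertwinerB : spin_hecke :=
  2%:R * spin_b n ^+ 2 * spin_t n - v *: spin_b n.

End SpinAffineHecke.

(* Main.v *)
Require Import Defs.
From mathcomp Require Import all_boot all_order all_algebra.
From mathcomp Require Import reals complex zify.
From mathcomp.multinomials Require Import monalg.

Import GRing.Theory.
Local Open Scope ring_scope.

(** All the identities take place in the subalgebra generated by one [t] and at
    most three [b]'s. The relation [t x + y t = u] moves [t] across [x], and
    anticommutation of [x] and [y] makes [x^2] and [y^2] commute with both;
    expanding then gives [I x = - y I] for [I = (y^2 - x^2) t - u (y - x)].
    Conjugating the relation by the involution [t] exchanges [x] and [y], and
    the same exchange turns [I] into [- I], so [I y = - x I] is the same
    identity. *)

(** * Identities in an arbitrary ring, with a commuting element [c] in place of the parameter *)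

Section Intertwining.
Set Implicit Arguments.
Unset Strict Implicit.
Variable A : pzRingType.
Implicit Types c t x y z : A.

Lemma anticomm_sqr x y : x * y = - (y * x) -> x ^+ 2 * y = y * x ^+ 2.
Proof. by move=> xy; rewrite expr2 -mulrA xy mulrN mulrA xy mulNr opprK mulrA. Qed.

Lemma skew_relation_swap c t x y :
    t ^+ 2 = 1 -> GRing.comm c t -> t * x + y * t = c ->
  t * y + x * t = c.
Proof.
rewrite expr2 => tt ct e.
have : t * (t * x + y * t) * t = c by rewrite e -ct -mulrA tt mulr1.
by rewrite mulrDr mulrDl !mulrA tt mul1r -!mulrA tt mulr1 addrC.
Qed.

Lemma intertwiner_mul c t x y :
    GRing.comm c x -> GRing.comm c y ->
    t * x + y * t = c -> x * y = - (y * x) ->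
  ((y ^+ 2 - x ^+ 2) * t - c * (y - x)) * x
    = - y * ((y ^+ 2 - x ^+ 2) * t - c * (y - x)).
Proof.
move=> cx cy e xy; set S := y ^+ 2 - x ^+ 2.
have tx : t * x = c - y * t by rewrite -e addrK.
have cS : S * c = c * S by apply/commr_sym/commrB; apply: commrX.
have yS : S * y = y * S.
  by rewrite mulrBl mulrBr (anticomm_sqr xy) -exprSr -exprS.
(* Replacing [t * x] by [c - y * t] leaves [c * (S - (y - x) * x) - y * S * t]; this factorization
   pulls [y] out of the part free of [t]. *)
have Sd : S - (y - x) * x = y * (y - x).
  by rewrite mulrBl mulrBr -!expr2 opprB addrA subrK.
rewrite mulrBl -mulrA tx mulrBr cS mulrA yS addrAC -(mulrA c) -mulrBr Sd.
by rewrite [RHS]mulNr [y * (_ - c * _)]mulrBr opprB !mulrA cy.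
Qed.

Lemma intertwiner_mul_swap c t x y :
    t ^+ 2 = 1 -> GRing.comm c t -> GRing.comm c x -> GRing.comm c y ->
    t * x + y * t = c -> x * y = - (y * x) ->
  ((y ^+ 2 - x ^+ 2) * t - c * (y - x)) * y
    = - x * ((y ^+ 2 - x ^+ 2) * t - c * (y - x)).
Proof.
move=> tt ct cx cy /(skew_relation_swap tt ct) e xy.
have -> : (y ^+ 2 - x ^+ 2) * t - c * (y - x)
    = - ((x ^+ 2 - y ^+ 2) * t - c * (x - y)).
  by rewrite [RHS]opprD -[- (_ * t)]mulNr -[- (c * (x - y))]mulrN !opprB.
rewrite [LHS]mulNr mulrN; congr (- _).
by apply: intertwiner_mul => //; rewrite xy opprK.
Qed.

(** A parity count: [z] anticommutes with [t], [x] and [y], and both terms of the intertwiner have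
    odd degree in these, while [c] commutes with [z]. *)
Lemma intertwiner_anticomm c t x y z :
    GRing.comm c z -> t * z = - (z * t) -> x * z = - (z * x) ->
    y * z = - (z * y) ->
  ((y ^+ 2 - x ^+ 2) * t - c * (y - x)) * z
    = - z * ((y ^+ 2 - x ^+ 2) * t - c * (y - x)).
Proof.
move=> cz tz xz yz.
set S := y ^+ 2 - x ^+ 2; set d := y - x.
have Sz : S * z = z * S by rewrite mulrBl mulrBr !anticomm_sqr.
have dz : d * z = - (z * d) by rewrite mulrBl mulrBr xz yz opprD.
clearbody S d; rewrite mulrBl -!mulrA tz dz !mulrN mulNr mulrBr opprD.
by rewrite !mulrA Sz cz.
Qed.

(** Moving [t] across [x] in the two copies of [x ^+ 2 * t] produces [x * (c * x)] twice; the term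
    [- c * x] cancels one of them, and the other is what the right-hand side requires. *)
Lemma intertwinerB_mul c t x :
    GRing.comm c x -> t * x + x * t = c ->
  (2%:R * x ^+ 2 * t - c * x) * x = - x * (2%:R * x ^+ 2 * t - c * x).
Proof.
move=> cx e; rewrite -mulrA mulr_natl mulr2n; set q := x ^+ 2 * t.
have qx : q * x = x * (c * x) - x * q.
  by rewrite /q -mulrA (canRL (addrK _) e) mulrBr expr2 -!mulrA -cx.
have cxx : c * x * x = x * (c * x) by rewrite mulrA -cx.
clearbody q; rewrite mulrBl mulrDl qx cxx mulNr mulrBr mulrDr opprB.
by rewrite addrACA -opprD addrAC addrK.
Qed.

Lemma intertwinerB_anticomm c t x z :
    GRing.comm c z -> t * z = - (z * t) -> x * z = - (z * x) ->
  (2%:R * x ^+ 2 * t - c * x) * z = - z * (2%:R * x ^+ 2 * t - c * x).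
Proof.
move=> cz tz xz; rewrite -mulrA mulr_natl mulr2n.
have qz : x ^+ 2 * t * z = - (z * (x ^+ 2 * t)).
  by rewrite -mulrA tz mulrN mulrA anticomm_sqr // -mulrA.
have cxz : c * x * z = - (z * (c * x)) by rewrite -mulrA xz mulrN !mulrA cz.
by rewrite mulrBl mulrDl qz cxz mulNr mulrBr mulrDr !opprD !opprK.
Qed.

End Intertwining.

(** * The defining relations as equations in the quotient algebra *)

Section SpinHecke.
Set Implicit Arguments.
Unset Strict Implicit.
Variables (K : comNzRingType) (W : weyl_type) (n : nat) (u v : K).
Local Notation H := (spin_hecke W n u v).
Local Notation rel := (@spin_rel K W n u v).
Local Notation pi := (\pi_(presAlg rel))%qT.
Local Notation b := (spin_b W n u v).
Local Notation t := (spin_t W n u v).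

Implicit Types x y z w : freeAlg K (spin_gen W n).

(** Lets the element [k *: 1] serve as [c] in the ring identities above. *)
Lemma scale1_comm (k : K) (h : H) : GRing.comm (k *: (1 : H)) h.
Proof.
by rewrite /GRing.comm -presAlg_scalerAl -presAlg_scalerAr mul1r mulr1.
Qed.

Lemma scale1_mul (k : K) (h : H) : k *: h = k *: (1 : H) * h.
Proof. by rewrite -presAlg_scalerAl mul1r. Qed.

Lemma pi_oppr x : pi (- x) = - pi x :> H.
Proof. by rewrite -sub0r pi_presAlg_zmod_morphism !piE sub0r. Qed.

Lemma pi_sqr_rel x : rel (x ^+ 2) 1 -> (pi x : H) ^+ 2 = 1.
Proof.
have [pi1 piM] := pi_presAlg_monoid_morphism rel.
by move=> /presAlg_rel; rewrite expr2 piM pi1.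
Qed.

Lemma pi_anticomm_rel x y :
  rel (x * y) (- (y * x)) -> (pi x : H) * pi y = - (pi y * pi x : H).
Proof.
have [_ piM] := pi_presAlg_monoid_morphism rel.
by move=> r; rewrite -!piM -pi_oppr; exact: presAlg_rel.
Qed.

Lemma pi_skew_rel x y z w k :
  rel (x * y + z * w) k%:A ->
  (pi x : H) * pi y + pi z * pi w = k *: (1 : H).
Proof.
have [pi1 piM] := pi_presAlg_monoid_morphism rel.
(* Additivity of [pi] is available for differences, so the sum is written as the difference with an
   opposite. *)
move=> r; rewrite -(piM x y) -(piM z w) -[pi (z * w)]opprK -pi_oppr.
rewrite -pi_presAlg_zmod_morphism opprK -pi1 -pi_presAlg_scalable.
exact: presAlg_rel.
Qed.

Lemma spin_b_anticomm i j : (1 <= i <= n)%N -> (1 <= j <= n)%N -> i <> j ->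
  b i * b j = - (b j * b i).
Proof. by move=> hi hj /eqP ij; apply/pi_anticomm_rel/spin_b_anti. Qed.

Lemma spin_t_involution i : (1 <= i <= num_t W n)%N -> t i ^+ 2 = 1.
Proof. by move=> hi; apply/pi_sqr_rel/spin_t_sqr. Qed.

Lemma spin_t_skew i : (1 <= i <= n - 1)%N ->
  t i * b i + b i.+1 * t i = u *: (1 : H).
Proof. by move=> hi; apply/pi_skew_rel/spin_tb. Qed.

Lemma spin_t_anticomm i j : (1 <= i <= n - 1)%N -> (1 <= j <= n)%N ->
  j <> i -> j <> i.+1 -> t i * b j = - (b j * t i).
Proof.
by move=> hi hj /eqP ji /eqP ji1; apply/pi_anticomm_rel/spin_tb_anti.
Qed.

Lemma spin_tD_skew : W = TypeD ->
  t n * b n + b (n - 1) * t n = u *: (1 : H).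
Proof. by move=> eW; apply/pi_skew_rel/spin_tbD. Qed.

Lemma spin_tD_anticomm i : W = TypeD -> (1 <= i <= n)%N ->
  i <> (n - 1)%N -> i <> n -> t n * b i = - (b i * t n).
Proof.
by move=> eW hi /eqP in1 /eqP in0; apply/pi_anticomm_rel/spin_tb_antiD.
Qed.

Lemma spin_tB_skew : W = TypeB -> t n * b n + b n * t n = v *: (1 : H).
Proof. by move=> eW; apply/pi_skew_rel/spin_tbB. Qed.

Lemma spin_tB_anticomm i : W = TypeB -> (1 <= i <= n)%N -> i <> n ->
  t n * b i = - (b i * t n).
Proof. by move=> eW hi /eqP in0; apply/pi_anticomm_rel/spin_tb_antiB. Qed.

(** * The intertwiner identities, type by type *)

Local Notation I_ := (intertwiner W n u v).
Local Notation InD := (intertwinerD W n u v).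
Local Notation InB := (intertwinerB W n u v).

Lemma intertwiner_spin_b i j :
    (1 <= i <= n - 1)%N -> (1 <= j <= n)%N ->
  [/\ I_ i * b i = - b i.+1 * I_ i,
      I_ i * b i.+1 = - b i * I_ i &
      j <> i -> j <> i.+1 -> I_ i * b j = - b j * I_ i].
Proof.
move=> hi hj.
(* The range of [i] forces [2 <= n], so the truncated [n - 1] is a true predecessor and [i.+1] is a
   valid index. *)
have i_n : (1 <= i <= n)%N by lia.
have i1_n : (1 <= i.+1 <= n)%N by lia.
have i_t : (1 <= i <= num_t W n)%N by case: (W) => /=; lia.
have bb : b i * b i.+1 = - (b i.+1 * b i) by apply: spin_b_anticomm; lia.
have cC := scale1_comm u.
rewrite /intertwiner scale1_mul; split=> [||ji ji1].
- exact: intertwiner_mul (cC _) (cC _) (spin_t_skew hi) bb.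
- have tt := spin_t_involution i_t.
  exact: intertwiner_mul_swap tt (cC _) (cC _) (cC _) (spin_t_skew hi) bb.
- have bj := spin_b_anticomm i_n hj (nesym ji).
  have bj1 := spin_b_anticomm i1_n hj (nesym ji1).
  exact: intertwiner_anticomm (cC _) (spin_t_anticomm hi hj ji ji1) bj bj1.
Qed.

Lemma intertwinerD_spin_b : (2 <= n)%N -> W = TypeD ->
  [/\ InD * b (n - 1)%N = - b n * InD,
      InD * b n = - b (n - 1)%N * InD &
      forall i : nat, (1 <= i <= n)%N -> i <> (n - 1)%N -> i <> n ->
        InD * b i = - b i * InD].
Proof.
move=> n2 eW.
have n1_n : (1 <= n - 1 <= n)%N by lia.
have n_n : (1 <= n <= n)%N by lia.
have tt : t n ^+ 2 = 1 by apply: spin_t_involution; rewrite eW.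
have cC := scale1_comm u.
(* The type D relation has [b n] to the right of [t n]; the swap fits it to [x = b (n - 1)],
   [y = b n], the order used in [intertwinerD]. *)
have e := skew_relation_swap tt (cC _) (spin_tD_skew eW).
have bb : b (n - 1)%N * b n = - (b n * b (n - 1)%N).
  by apply: spin_b_anticomm; lia.
rewrite /intertwinerD scale1_mul; split=> [||i hi in1 in0].
- exact: intertwiner_mul (cC _) (cC _) e bb.
- exact: intertwiner_mul_swap tt (cC _) (cC _) (cC _) e bb.
- have bn1 := spin_b_anticomm n1_n hi (nesym in1).
  have bn := spin_b_anticomm n_n hi (nesym in0).
  exact: intertwiner_anticomm (cC _) (spin_tD_anticomm eW hi in1 in0) bn1 bn.
Qed.

Lemma intertwinerB_spin_b : (1 <= n)%N -> W = TypeB ->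
  InB * b n = - b n * InB /\
  (forall i : nat, (1 <= i <= n)%N -> i <> n -> InB * b i = - b i * InB).
Proof.
move=> n1 eW; have cC := scale1_comm v.
rewrite /intertwinerB scale1_mul; split=> [|i hi in0].
- exact: intertwinerB_mul (cC _) (spin_tB_skew eW).
- have n_n : (1 <= n <= n)%N by lia.
  have bn := spin_b_anticomm n_n hi (nesym in0).
  exact: intertwinerB_anticomm (cC _) (spin_tB_anticomm eW hi in0) bn.
Qed.

End SpinHecke.

Theorem proposition4p7 (R : realType) (W : weyl_type) (n : nat) (u v : R[i])
    (hn : ((if W is TypeD then 4 else 2) <= n)%N) :
  let b := spin_b W n u v in
  let I_ := intertwiner W n u v in
  let InD := intertwinerD W n u v in
  let InB := intertwinerB W n u v in
  [/\ forall i j : nat, (1 <= i <= n - 1)%N -> (1 <= j <= n)%N ->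
        [/\ I_ i * b i = - b i.+1 * I_ i,
            I_ i * b i.+1 = - b i * I_ i &
            j <> i -> j <> i.+1 -> I_ i * b j = - b j * I_ i],
      W = TypeD ->
        [/\ InD * b (n - 1)%N = - b n * InD,
            InD * b n = - b (n - 1)%N * InD &
            forall i : nat, (1 <= i <= n)%N -> i <> (n - 1)%N -> i <> n ->
              InD * b i = - b i * InD] &
      W = TypeB ->
        InB * b n = - b n * InB /\
        (forall i : nat, (1 <= i <= n)%N -> i <> n ->
           InB * b i = - b i * InB)].
Proof.
have n2 : (2 <= n)%N by case: W hn => // /ltnW/ltnW.
split=> [i j||]; first exact: intertwiner_spin_b.
- exact: intertwinerD_spin_b.
- exact/intertwinerB_spin_b/ltnW.
Qed.
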